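(* Let $\mathbb{K}$ be a field, let $t \ge 2$ be an integer, and let $C_n$ denote the cycle graph on $n$ vertices. (1) $C_{2t+1}$ is $t$-gap-free, but the $t$-connected ideal $J_t(C_{2t+1}) \subset \mathbb{K}[C_{2t+1}]$ does not have a linear resolution. (2) If $t \ge 3$, then $C_{2t}$ is $t$-gap-free, but $J_t(C_{2t}) \subset \mathbb{K}[C_{2t}]$ does not have a linear resolution. In particular, these ideals (namely $J_t(C_{2t+1})$ for $t \ge 2$, and $J_t(C_{2t})$ for $t\ge 3$) do not have linear quotients.
   Context: For a finite simple graph $G$, a subset $C \subset V(G)$ is $t$-connected if $|C| = t$ and the induced subgraph $G[C]$ is connected. $\mathbb{K}[G]$ is the polynomial ring over $\mathbb{K}$ in the variables $\{x_v : v \in V(G)\}$, and $x_C = \prod_{c\in C} x_c$. The $t$-connected ideal is $J_t(G) = \langle x_C : C \subset V(G) \text{ is } t\text{-connected}\rangle \subset \mathbb{K}[G]$. A monomial ideal $I$ with minimal monomial generating set $\operatorname{mingens}(I)$ has linear quotients if there is an order $u_1 < \cdots < u_m$ on $\operatorname{mingens}(I)$ such that for each $i = 2,\dots,m$ the colon ideal $\langle u_1,\dots,u_{i-1}\rangle : \langle u_i\rangle$ is generated by a subset of the variables. The zero ideal is considered to have linear quotients. A homogeneous ideal $I$ of a polynomial ring (standard grading) generated by its degree $t$ elements has a linear resolution if its graded Betti numbers satisfy $\beta_{i,j}(I) = 0$ for all $j \ne i + t$. The zero ideal is also said to have a linear resolution. Let $\mathcal{H}(G,t)$ be the hypergraph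 with vertex set $V(G)$ and hyperedges the $t$-connected subsets of $V(G)$. A matching in a hypergraph is a set of pairwise disjoint hyperedges; a matching $\{E_1,\dots,E_s\}$ is induced if every hyperedge $E \subset E_1 \sqcup \cdots \sqcup E_s$ equals some $E_i$. The induced matching number $\gamma(\mathcal{H})$ is the maximum cardinality of an induced matching in $\mathcal{H}$. $G$ is $t$-gap-free if $\gamma(\mathcal{H}(G,t)) \le 1$. *)

(* Defs.v *)
From mathcomp Require Import all_boot all_algebra.
From mathcomp Require Import mpoly.

Set Implicit Arguments.
Unset Strict Implicit.
Unset Printing Implicit Defensive.

Import GRing.Theory.
Local Open Scope ring_scope.

Record sgraph (V : finType) := SGraph {
  adj :> rel V;
  adj_sym : ssrbool.symmetric adj;
  adj_irr : irreflexive adj }.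

(* [i != j] only matters for n = 1, where [i] is its own successor mod n. *)
Definition cycle_adj (n : nat) : rel 'I_n := fun i j =>
  (i != j) && ((j == i.+1 %% n :> nat) || (i == j.+1 %% n :> nat))%N.

Lemma cycle_adj_sym n : ssrbool.symmetric (@cycle_adj n).
Proof. by move=> i j; rewrite /cycle_adj eq_sym orbC. Qed.

Lemma cycle_adj_irr n : irreflexive (@cycle_adj n).
Proof. by move=> i; rewrite /cycle_adj eqxx. Qed.

Definition cycle_graph (n : nat) : sgraph 'I_n :=
  SGraph (@cycle_adj_sym n) (@cycle_adj_irr n).

Section Hypergraphs.
Variable V : finType.

Definition induced_connected (G : sgraph V) (C : {set V}) : bool :=
  [forall x in C, forall y in C,
    connect [rel u v | [&& u \in C, v \in C & G u v]] x y].

Definition t_connected (G : sgraph V) (t : nat) (C : {set V}) : bool :=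
  (#|C| == t) && induced_connected G C.

Definition connected_hypergraph (G : sgraph V) (t : nat) : {set {set V}} :=
  [set C | t_connected G t C].

Definition matching (H M : {set {set V}}) : bool :=
  (M \subset H) && trivIset M.

Definition induced_matching (H M : {set {set V}}) : bool :=
  matching H M && [forall E in H, (E \subset cover M) ==> (E \in M)].

Definition induced_matching_number (H : {set {set V}}) : nat :=
  \max_(M : {set {set V}} | induced_matching H M) #|M|.

Definition gap_free (t : nat) (G : sgraph V) : Prop :=
  (induced_matching_number (connected_hypergraph G t) <= 1)%N.

End Hypergraphs.

Section Ideals.
Variables (K : fieldType) (n : nat).
Local Notation S := {mpoly K[n]}.

Definition ideal_gen (P : S -> Prop) (f : S) : Prop :=
  exists (k : nat) (c g : 'I_k -> S),
    (forall i, P (g i)) /\ f = \sum_(i < k) c i * g i.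

Definition monomial_ideal_of (s : seq 'X_{1..n}) : S -> Prop :=
  ideal_gen (fun g => exists2 m, m \in s & g = 'X_[m]).

Definition variable_ideal_of (A : {set 'I_n}) : S -> Prop :=
  ideal_gen (fun g => exists2 v, v \in A & g = 'X_v).

Definition colon_principal (I : S -> Prop) (u : S) : S -> Prop :=
  fun f => I (f * u).

Definition set_monomial (C : {set 'I_n}) : S := \prod_(v in C) 'X_v.

Definition connected_ideal (t : nat) (G : sgraph 'I_n) : S -> Prop :=
  ideal_gen (fun g => exists2 C, t_connected G t C & g = set_monomial C).

(* The monomials of I that are minimal for divisibility; for a monomial ideal
   these are its minimal monomial generators. *)
Definition mingen (I : S -> Prop) (m : 'X_{1..n}) : Prop :=
  I 'X_[m] /\ forall m', I 'X_[m'] -> (m' <= m)%MM -> m' = m.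

(* Meaningful for monomial ideals; the zero ideal is covered by s = [::]. *)
Definition has_linear_quotients (I : S -> Prop) : Prop :=
  exists s : seq 'X_{1..n},
    [/\ uniq s, forall m, m \in s <-> mingen I m
      & forall i, (0 < i < size s)%N -> exists A : {set 'I_n}, forall f,
          colon_principal (monomial_ideal_of (take i s)) 'X_[nth 0%MM s i] f
          <-> variable_ideal_of A f].

(* Graded free modules F_i = \bigoplus_k S(- shift i k) and maps
   ... -> F_1 -> F_0 -> S. Elements are row vectors, matrices act on the right.
   Nonnegative shifts suffice: in a minimal resolution of an ideal of S all
   shifts are degrees of nonzero homogeneous elements. *)
Record free_complex := FreeComplex {
  rk : nat -> nat;
  shift : forall i, 'I_(rk i) -> nat;
  aug : 'cV[S]_(rk 0);
  diff : forall i, 'M[S]_(rk i.+1, rk i) }.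

(* The guard is needed because the subtraction on nat is truncated. *)
Definition graded (F : free_complex) : Prop :=
  (forall k, aug F k 0 \is (shift k).-homog) /\
  (forall i k l, diff F i k l = 0 \/
     (shift l <= shift k)%N /\ diff F i k l \is (shift k - shift l).-homog).

Definition resolves (F : free_complex) (I : S -> Prop) : Prop :=
  [/\ forall f, I f <-> exists v : 'rV_(rk F 0), v *m aug F = f%:M,
      forall v : 'rV_(rk F 0),
        v *m aug F = 0 <-> exists w, v = w *m diff F 0
    & forall i (v : 'rV_(rk F i.+1)),
        v *m diff F i = 0 <-> exists w, v = w *m diff F i.+1].

(* The image of F_{i+1} lies in (x_0, ..., x_{n-1}) F_i. *)
Definition minimal (F : free_complex) : Prop :=
  forall i k l, (diff F i k l)@_0%MM = 0.

Definition minimal_graded_resolution (I : S -> Prop) (F : free_complex) : Prop :=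
  [/\ graded F, resolves F I & minimal F].

Definition betti (F : free_complex) (i j : nat) : nat :=
  #|[set k : 'I_(rk F i) | shift k == j]|.

(* A minimal graded free resolution of a homogeneous ideal exists and is unique
   up to isomorphism, so b is the table of graded Betti numbers of I. *)
Definition graded_betti (I : S -> Prop) (b : nat -> nat -> nat) : Prop :=
  exists2 F, minimal_graded_resolution I F & forall i j, b i j = betti F i j.

(* The condition for i = 0 already says that I is generated in degree t; the
   zero ideal is covered by b = 0. *)
Definition has_linear_resolution (t : nat) (I : S -> Prop) : Prop :=
  exists2 b, graded_betti I b & forall i j, j != (i + t)%N -> b i j = 0%N.

End Ideals.

Arguments connected_ideal K {n} t G.

(* Main.v *)
Require Import Defs.
From mathcomp Require Import all_boot all_algebra.
From mathcomp Require Import zify mpoly.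

(* For 1 < t < n - 2 the t-connected subsets of C_n are the arcs A_i = {i, ..., i + t - 1}.
   If n is 2t or 2t + 1, two disjoint arcs are consecutive up to exchange, so that
   their union contains a third one; this is the gap-freeness.

   Every linear syzygy of the generators m_i = x_{A_i} is a combination of the
   sigma_i = x_{i+t} e_i - x_i e_{i+1}. Going once around the cycle gives a nonzero
   relation between the sigma_i, with coefficients prod_{v notin A_i, v <> i+t} x_v,
   whereas the sigma_i have no nonzero relation with linear coefficients. In a linear
   resolution F_0 and F_1 would, up to constant changes of basis, be spanned by the m_i
   and the sigma_i, and F_2 would map to zero, contradicting exactness at F_1.

   For linear quotients, arcs m_i and m_j with a colon generated by a variable have
   j = i - 1 or j = i + 1. Hence the arcs used so far start on an interval of the cycle,
   as long as at least two arcs are missing. When exactly two are missing, the next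
   generator has one neighbour among the previous ones, and some previous arc avoids
   the only variable this neighbour contributes to the colon. *)

Set Implicit Arguments.
Unset Strict Implicit.
Unset Printing Implicit Defensive.

Import GRing.Theory.

(** * Arcs of a cycle *)
Section Arcs.
Local Open Scope nat_scope.
Variable n : nat.
Implicit Types (i j k v u : 'I_n.+1) (t : nat).

(* The number of steps from i to v around the cycle, in increasing direction. *)
Definition cdist i v := if i <= v then v - i else v + n.+1 - i.

Definition rot_ord i (d : nat) : 'I_n.+1 := inord ((i + d) %% n.+1).

Definition carc t i : {set 'I_n.+1} := [set v | cdist i v < t].

(** Stating the wrap-around as a case split without truncated subtraction, here and in [rot_ordE],
    lets [lia] settle positions on the cycle. *)
Lemma cdistE i v :
  i <= v /\ cdist i v + i = v \/ v < i /\ cdist i v + i = v + n.+1.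
Proof.
have := ltn_ord i; rewrite /cdist; case: ifP => le ?; [left|right]; lia.
Qed.

Lemma rot_ordE i d : d <= n ->
  i + d <= n /\ rot_ord i d = i + d :> nat
  \/ n < i + d /\ rot_ord i d + n.+1 = i + d :> nat.
Proof.
move=> dn; rewrite inordK ?ltn_mod //; have := ltn_ord i.
have [le_n|lt_n] := leqP (i + d) n => ?; first by left; rewrite modn_small.
right; split=> //; have -> : i + d = (i + d - n.+1) + n.+1 by lia.
by rewrite modnDr modn_small; lia.
Qed.

Lemma cdist_rot i d : d <= n -> cdist i (rot_ord i d) = d.
Proof.
move=> dn; have := rot_ordE i dn; have := cdistE i (rot_ord i d).
by have := ltn_ord i; lia.
Qed.

Lemma rot_cdist i v : rot_ord i (cdist i v) = v.
Proof.
have := cdistE i v; have := ltn_ord i; have := ltn_ord v => ? ? ?.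
have /(rot_ordE i) : cdist i v <= n by lia.
by move=> ?; apply/val_inj => /=; lia.
Qed.

Lemma cdist_le i v : cdist i v <= n.
Proof. by have := cdistE i v; have := ltn_ord i; have := ltn_ord v; lia. Qed.

Lemma cdist_inj i : injective (cdist i).
Proof. by move=> u v e; rewrite -(rot_cdist i u) e rot_cdist. Qed.

Lemma cdistii i : cdist i i = 0.
Proof. by rewrite /cdist leqnn subnn. Qed.

Lemma rot0 i : rot_ord i 0 = i.
Proof. by apply: (@cdist_inj i); rewrite cdist_rot // cdistii. Qed.

Lemma in_arc t i v : (v \in carc t i) = (cdist i v < t).
Proof. by rewrite inE. Qed.

Lemma card_arc t i : t <= n.+1 -> #|carc t i| = t.
Proof.
move=> tn; pose f (k : 'I_t) := rot_ord i k.
have fK (k : 'I_t) : cdist i (f k) = k :> nat.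
  by rewrite cdist_rot //; have := ltn_ord k; lia.
have -> : carc t i = f @: setT.
  apply/setP=> v; rewrite in_arc; apply/idP/imsetP => [vt|[k _ ->]].
    by exists (Ordinal vt); rewrite ?inE // /f rot_cdist.
  by rewrite fK.
rewrite card_imset ?cardsT ?card_ord // => k l e.
by apply/val_inj; rewrite /= -fK e fK.
Qed.

(* rot_ord i n is the predecessor of i. *)
Lemma arc_sub t i j v : 2 <= t -> t.+1 <= n ->
    carc t j \subset v |: carc t i ->
  [\/ j = i, v = rot_ord i t /\ j = rot_ord i 1
    | v = rot_ord i n /\ j = v].
Proof.
move=> t2 tn /subsetP sub.
have out d : d <= n -> t <= d -> cdist j (rot_ord i d) < t -> v = rot_ord i d.
  move=> dn td; rewrite -in_arc => /sub; rewrite !inE cdist_rot // => /orP[/eqP//|].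
  by rewrite ltnNge td.
have E d : d <= n -> cdist j (rot_ord i d) < t -> t <= d -> cdist i v = d.
  by move=> dn *; rewrite (out d) ?cdist_rot.
have dj := cdistE i j; have li := ltn_ord i; have lj := ltn_ord j.
have R d : d <= n -> cdist i j <= d ->
    cdist j (rot_ord i d) = d - cdist i j.
  by move=> dn d0; have := rot_ordE i dn; have := cdistE j (rot_ord i d); lia.
have := cdist_le i j => ln.
have [d0|d0] := posnP (cdist i j).
  by constructor 1; apply: (@cdist_inj i); rewrite d0 cdistii.
have [lt|ge] := ltnP (cdist i j) t.
  have [d1|d2] := leqP (cdist i j) 1.
    have d1' : cdist i j = 1 by lia.
    constructor 2; rewrite -d1' rot_cdist; split=> //.
    apply: out; try lia.
    by rewrite R; lia.
  (* If [j] lies 2 to t - 1 steps after [i], its arc contains the vertices t and t + 1 steps after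
     [i]; both would have to be [v]. *)
  by have := E t; have := E t.+1; rewrite !R; lia.
have [d1|d2] := ltnP (cdist i j) n.
  (* Now [j] and its successor both lie outside the arc at [i], and again both would be [v]. *)
  by have := E (cdist i j); have := E (cdist i j).+1; rewrite !R; lia.
have dn : cdist i j = n by lia.
constructor 3; have vi : v = rot_ord i n by apply: out; rewrite ?R; lia.
by split=> //; rewrite vi; apply: (@cdist_inj i); rewrite cdist_rot.
Qed.

Lemma arc_inj t : 2 <= t -> t.+1 <= n -> injective (carc t).
Proof.
move=> t2 tn j i e.
have := @arc_sub t i j i t2 tn; rewrite e subsetUr => /(_ isT) [//||] [e1 _].
  by have := cdist_rot i (d := t); rewrite -e1 cdistii; lia.
by have := cdist_rot i (leqnn n); rewrite -e1 cdistii; lia.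
Qed.

Lemma cycle_adjE i v : 0 < n -> cycle_adj i v =
  (cdist i v == 1) || (cdist i v == n).
Proof.
move=> n0; rewrite /cycle_adj -val_eqE /=.
have S k : k.+1 %% n.+1 = if k == n :> nat then 0 else k.+1.
  case: eqP => [->|/eqP ne]; first exact: modnn.
  by rewrite modn_small //; have := ltn_ord k; lia.
rewrite !S; have := cdistE i v; have := ltn_ord i; have := ltn_ord v.
by do 2! case: ifP => ?; lia.
Qed.

Lemma arc_connected t i : t <= n.+1 -> 0 < n ->
  t_connected (cycle_graph n.+1) t (carc t i).
Proof.
move=> tn n0; rewrite /t_connected card_arc // eqxx /=.
set e := [rel u v | [&& u \in carc t i, v \in carc t i & cycle_graph n.+1 u v]].
have es : connect_sym e.
  by apply: sym_connect_sym => u v /=; rewrite cycle_adj_sym andbCA.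
have conn v : v \in carc t i -> connect e i v.
  rewrite in_arc -(rot_cdist i v); have := cdist_le i v.
  elim: (cdist i v) => [|d IH] dn; rewrite cdist_rot // => dt.
    by rewrite rot0 connect0.
  have d1 : d <= n by lia.
  apply: connect_trans (IH _ _) _; rewrite ?cdist_rot //; try lia.
  apply: connect1; rewrite /= !in_arc !cdist_rot // dt (ltnW dt) /=.
  rewrite cycle_adjE //; apply/orP; left; apply/eqP.
  have := rot_ordE i dn; have := rot_ordE i d1.
  by have := cdistE (rot_ord i d) (rot_ord i d.+1); have := ltn_ord i; lia.
apply/'forall_implyP=> u ui; apply/'forall_implyP=> v vi.
by apply: connect_trans (conn v vi); rewrite es conn.
Qed.

(** Start at a member [i] whose predecessor is missing and let [d] be the distance to the first
    missing vertex. By connectedness [C] cannot reach beyond this gap, and counting gives the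
    arc. *)
Lemma t_connected_arc t (C : {set 'I_n.+1}) : 0 < t <= n ->
  t_connected (cycle_graph n.+1) t C -> exists i, C = carc t i.
Proof.
move=> /andP[t0 tn] /andP[/eqP cC /'forall_implyP conn].
have n0 : 0 < n by lia.
have [i iC iN] : exists2 i, i \in C & rot_ord i n \notin C.
  apply/exists_inP/negbNE/negP => /exists_inPn all_in.
  have [v0 v0C] : exists v, v \in C by apply/set0Pn; rewrite -card_gt0 cC.
  (* A nonempty set closed under predecessors is the whole cycle, which has more than t vertices. *)
  have down d : d <= n -> rot_ord v0 (n.+1 - d.+1) \in C.
    elim: d => [|d IH] dn.
      by rewrite subSS subn0; have := all_in _ v0C; rewrite negbK.
    have /all_in := IH (ltnW dn); rewrite negbK.
    congr (_ \in C); apply: val_inj => /=; set r := rot_ord v0 (n.+1 - d.+1).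
    have := rot_ordE r (leqnn n); have := @rot_ordE v0 (n.+1 - d.+1).
    have := @rot_ordE v0 (n.+1 - d.+2); have := ltn_ord v0; rewrite -/r; lia.
  have : C = setT.
    apply/setP=> v; rewrite inE -(rot_cdist v0 v).
    have := cdist_le v0 v => le.
    have := down (n - cdist v0 v) (leq_subr _ _).
    by congr (rot_ord v0 _ \in C); lia.
  by move=> CT; move: cC; rewrite CT cardsT card_ord; lia.
have exN : exists d, (d <= n) && (rot_ord i d \notin C) by exists n; rewrite leqnn.
case: (ex_minnP exN) => d /andP[dn dN] dmin.
have sub : C \subset carc d i.
  apply/subsetP=> v vC; have /'forall_implyP/(_ v vC) := conn i iC.
  set e := (X in connect X).
  (* An edge leaving these vertices would end at distance [d] or [n] from [i], and neither endpoint
     is in [C]. *)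
  have cl : closed e [pred u | cdist i u < d].
    apply: intro_closed.
      by apply: sym_connect_sym => x y; rewrite /e /= cycle_adj_sym andbCA.
    move=> x y /and3P[xC yC]; rewrite /= cycle_adjE // !inE => xy xd.
    have dy : cdist i y != d by apply: contraNneq dN => <-; rewrite rot_cdist.
    have ni : cdist i y != n.
      by apply: contraNneq iN => e0; have := rot_cdist i y; rewrite e0 => ->.
    move: xy dy ni xd; have := cdistE i y; have := cdistE i x; have := cdistE x y.
    have := ltn_ord i; have := ltn_ord x; have := ltn_ord y; lia.
  move/(closed_connect cl); rewrite !inE => <-.
  by rewrite cdistii lt0n; apply: contraNneq dN => ->; rewrite rot0.
have td : t <= d by rewrite -cC -(@card_arc d i) ?subset_leq_card //; lia.
exists i; apply/esym/eqP; rewrite eqEcard card_arc ?cC ?leqnn ?andbT; last lia.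
apply/subsetP=> v; rewrite in_arc => vt; rewrite -(rot_cdist i v).
apply: contraTT td => vN; rewrite -ltnNge (leq_ltn_trans _ vt) //.
by apply: dmin; rewrite cdist_le.
Qed.

Lemma cycle_gap_free t : 2 <= t -> t.+1 <= n -> 2 * t <= n.+1 <= 2 * t + 1 ->
  gap_free t (cycle_graph n.+1).
Proof.
move=> t2 tn n2; have tn0 : 0 < t <= n by lia.
rewrite /gap_free /induced_matching_number; apply/bigmax_leqP => M.
move=> /andP[/andP[/subsetP MH triv] /'forall_implyP ind].
rewrite leqNgt; apply/negP => /card_gt1P[E1 [E2 [E1M E2M E12]]].
have /trivIsetP/(_ _ _ E1M E2M E12) dis := triv.
have arcM E : E \in M -> exists i, E = carc t i.
  by move=> /MH; rewrite inE => /t_connected_arc; apply.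
have [i Ei] := arcM _ E1M; have [j Ej] := arcM _ E2M.
(* Disjointness makes both distances between [i] and [j] at least t, and they add up to n + 1, at
   most 2t + 1; so one of them is t. *)
wlog dij : E1 E2 i j E1M E2M E12 dis Ei Ej / cdist i j = t.
  move=> W; have : cdist i j = t \/ cdist j i = t.
    have ij : t <= cdist i j.
      rewrite leqNgt -in_arc -Ei; apply: contraTN dis => jE1.
      apply/pred0Pn; exists j; rewrite /= jE1 Ej inE cdistii; lia.
    have ji : t <= cdist j i.
      rewrite leqNgt -in_arc -Ej; apply: contraTN dis => iE2.
      apply/pred0Pn; exists i; rewrite /= iE2 Ei inE cdistii; lia.
    have := cdistE i j; have := cdistE j i; have := ltn_ord i; have := ltn_ord j.
    by lia.
  case=> [/(W E1 E2)|/(W E2 E1)]; apply=> //; first by rewrite eq_sym.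
  by rewrite disjoint_sym.
(* [E1] and [E2] are consecutive, so their union contains the arc at [k]; inducedness puts it into
   [M], although it meets [E1] in [k]. *)
pose k := rot_ord i 1; have k1 : 1 <= n by lia.
have := rot_ordE i k1; rewrite -/k => dk.
have kM : carc t k \in M.
  apply: (implyP (ind _ _)); first by rewrite inE arc_connected; lia.
  apply: (@subset_trans _ _ (E1 :|: E2)); last first.
    by rewrite subUset !bigcup_sup.
  apply/subsetP=> v; rewrite Ei Ej !inE.
  have := cdistE i v; have := cdistE j v; have := cdistE k v; have := cdistE i j.
  by have := ltn_ord v; have := ltn_ord i; have := ltn_ord j; lia.
have [e|/eqP ne] := eqVneq E1 (carc t k).
  have : i = k by apply: (@arc_inj t); rewrite -?Ei.
  by move=> /(congr1 val) /=; lia.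
have /trivIsetP/(_ _ _ E1M kM) := triv; move/eqP: ne => ne /(_ ne).
case/pred0Pn; exists k; rewrite /= Ei !inE.
by have := cdistE i k; have := cdistE k k; have := ltn_ord i; lia.
Qed.

End Arcs.

(** * Monomials of vertex sets and homogeneous matrices *)
Section Monomials.
Local Open Scope ring_scope.
Variables (K : fieldType) (n : nat).
Local Notation S := {mpoly K[n]}.
Implicit Types (p f : S) (m : 'X_{1..n}) (A : {set 'I_n}).

Definition set_mnm A : 'X_{1..n} := [multinom (v \in A : nat) | v < n].

Lemma set_mnmE A v : set_mnm A v = (v \in A).
Proof. exact: mnmE. Qed.

Lemma set_monomialE A : set_monomial K A = 'X_[set_mnm A].
Proof.
rewrite /set_monomial mpolyXE_id big_mkcond /=; apply: eq_bigr => v _.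
by rewrite set_mnmE; case: (v \in A).
Qed.

Lemma mdeg_set_mnm A : mdeg (set_mnm A) = #|A|.
Proof.
rewrite mdegE -sum1_card [RHS]big_mkcond /=; apply: eq_bigr => v _.
by rewrite set_mnmE; case: (v \in A).
Qed.

Lemma set_mnm_inj : injective set_mnm.
Proof.
move=> A B /mnmP e; apply/setP=> v; have := e v.
by rewrite !set_mnmE; case: (v \in A); case: (v \in B).
Qed.

Lemma set_mnm_le A m : (set_mnm A <= m)%MM = [forall v in A, 0 < m v]%N.
Proof.
apply/mnm_lepP/forall_inP => [le v vA|pos v].
  by have := le v; rewrite set_mnmE vA.
by rewrite set_mnmE; case: (boolP (v \in A)) => // /pos.
Qed.

Lemma mnm_le_mdeg m1 m2 : (m1 <= m2)%MM -> mdeg m1 = mdeg m2 -> m1 = m2.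
Proof.
move=> le; rewrite -(submK le) mdegD => /eqP.
by rewrite -{1}[mdeg m1]add0n eqn_add2r eq_sym mdeg_eq0 => /eqP ->; rewrite add0m.
Qed.

Lemma mcoeffMX_le p m m' : (p * 'X_[m])@_m' != 0 -> (m <= m')%MM.
Proof.
rewrite -mcoeff_msupp (perm_mem (msuppMX _ _)) => /mapP[k _ ->]; exact: lem_addr.
Qed.

Lemma ideal_gen_sub (P : S -> Prop) f : P f -> ideal_gen P f.
Proof.
move=> Pf; exists 1%N, (fun=> 1), (fun=> f); split=> //.
by rewrite big_ord1 mul1r.
Qed.

Lemma ideal_gen_mpolyX (P : S -> Prop) m m' :
  P 'X_[m'] -> (m' <= m)%MM -> ideal_gen P 'X_[m].
Proof.
move=> Pm' le; exists 1%N, (fun=> 'X_[m - m']), (fun=> 'X_[m']); split=> //.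
by rewrite big_ord1 -mpolyXD submK.
Qed.

(** A monomial that survives in the sum survives in one summand [c i * g i], hence is divisible by
    the monomial [g i]. *)
Lemma ideal_gen_mcoeff (P : S -> Prop) (Q : 'X_{1..n} -> Prop) f m :
    (forall g, P g -> exists2 m', Q m' & g = 'X_[m']) ->
    ideal_gen P f -> f@_m != 0 ->
  exists2 m', Q m' & (m' <= m)%MM.
Proof.
move=> PQ [k [c [g [Pg ->]]]]; rewrite raddf_sum /= => nz.
have [i nzi] : exists i, (c i * g i)@_m != 0.
  apply/existsP; apply: contraNT nz; rewrite negb_exists => /forallP z.
  by rewrite big1 // => i _; apply/eqP; have := z i; rewrite negbK.
have [m' Qm' gm] := PQ _ (Pg i).
by exists m' => //; move: nzi; rewrite gm => /mcoeffMX_le.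
Qed.

(** The part of [p] without constant term raises degrees, so it contributes nothing in degree
    [d]. *)
Lemma mcoeffM_homog d p f m : f \is d.-homog -> mdeg m = d ->
  (p * f)@_m = p@_0%MM * f@_m.
Proof.
move=> fd md; rewrite -mcoeffCM -[p in LHS](subrK (p@_0%MM)%:MP) mulrDl mcoeffD.
rewrite [X in X + _](_ : _ = 0) ?add0r // mcoeffM big1 // => -[k1 k2] /= /eqP e.
have [z|nz] := eqVneq (k1 : 'X_{1..n}) 0%MM.
  by rewrite z mcoeffB mcoeffC eqxx mulr1 subrr mul0r.
rewrite (dhomog_nemf_coeff fd) ?mulr0 //; apply: contraNneq nz => k2d.
by rewrite -mdeg_eq0 -(eqn_add2r d) -{1}k2d -mdegD -e md.
Qed.

Lemma linearE_mcoeff p : p \is 1.-homog -> (forall v, p@_U_(v) = 0) -> p = 0.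
Proof.
move=> p1 z; apply/mpolyP=> m; rewrite mcoeff0.
have [/mdeg1P[v /eqP->]|] := boolP (mdeg m == 1%N); first exact: z.
exact: dhomog_nemf_coeff.
Qed.

End Monomials.

(** * Constant and homogeneous matrices over the polynomial ring *)

Section ConstantMatrices.
Local Open Scope ring_scope.
Variables (K : fieldType) (n : nat).
Local Notation S := {mpoly K[n]}.

Definition cmx p q (M : 'M[K]_(p, q)) : 'M[S]_(p, q) := map_mx (@mpolyC n K) M.
Definition coef0_mx p q (M : 'M[S]_(p, q)) : 'M[K]_(p, q) :=
  map_mx (mcoeff 0%MM) M.

Lemma cmxM p q r (M : 'M[K]_(p, q)) (N : 'M_(q, r)) :
  cmx (M *m N) = cmx M *m cmx N.
Proof. exact: map_mxM. Qed.

Lemma cmx1 p : cmx (1%:M : 'M[K]_p) = 1%:M.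
Proof. exact: map_mx1. Qed.

Lemma coef0_mxM p q r (M : 'M[S]_(p, q)) (N : 'M_(q, r)) :
  coef0_mx (M *m N) = coef0_mx M *m coef0_mx N.
Proof. exact: map_mxM. Qed.

Lemma cmxK p q (M : 'M[K]_(p, q)) : coef0_mx (cmx M) = M.
Proof. by apply/matrixP=> i j; rewrite !mxE mpolyCK. Qed.

Definition mx_homog d p q (M : 'M[S]_(p, q)) := forall i j, M i j \is d.-homog.

Lemma mx_homogMr d p q r (M : 'M[S]_(p, q)) (N : 'M[K]_(q, r)) :
  mx_homog d M -> mx_homog d (M *m cmx N).
Proof.
move=> Md i j; rewrite mxE; apply: rpred_sum => k _.
by rewrite !mxE mulrC mul_mpolyC; apply/dhomogZ/Md.
Qed.

(* Only the constant terms of M contribute to the degree d part of M *m N. *)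
Lemma mx_homog_mul d p q r (M : 'M[S]_(p, q)) (N : 'M[S]_(q, r)) :
  mx_homog d N -> mx_homog d (M *m N) -> M *m N = cmx (coef0_mx M) *m N.
Proof.
move=> Nd MNd; apply/matrixP=> i j; apply/mpolyP=> m.
have [md|nd] := eqVneq (mdeg m) d.
  rewrite !mxE !raddf_sum /=; apply: eq_bigr => k _.
  by rewrite !mxE mcoeffCM (mcoeffM_homog _ (Nd k j)).
rewrite (dhomog_nemf_coeff (MNd i j)) // mxE raddf_sum big1 //= => k _.
by rewrite !mxE mcoeffCM (dhomog_nemf_coeff (Nd k j)) ?mulr0.
Qed.

Lemma mx_homog_coef0 d p q (M : 'M[S]_(p, q)) :
  (0 < d)%N -> mx_homog d M -> coef0_mx M = 0.
Proof.
move=> d0 Md; apply/matrixP=> i j; rewrite !mxE.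
by rewrite (dhomog_nemf_coeff (Md i j)) //= mdeg0 eq_sym -lt0n.
Qed.

Lemma row_solve p q r (N : 'M[S]_(q, r)) (M : 'M[S]_(p, r)) :
  (forall i, exists v, row i M = v *m N) -> exists V, M = V *m N.
Proof.
move=> /fin_all_exists[v vM]; exists (\matrix_i v i).
by apply/row_matrixP=> i; rewrite row_mul rowK vM.
Qed.

End ConstantMatrices.

(** * Syzygies of the arc monomials *)
Section CycleSyzygies.
Local Open Scope ring_scope.
Variables (K : fieldType) (n t : nat).
Hypotheses (t_gt1 : (1 < t)%N) (lt_t_n : (t.+1 < n)%N).
Local Notation S := {mpoly K[n.+1]}.
Local Notation J := (connected_ideal K t (cycle_graph n.+1)).
Implicit Types i j v u : 'I_n.+1.

Local Notation prev j := (rot_ord j n).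
Local Notation mA i := (set_mnm (carc t i)).

Let n_gt0 : (1 <= n)%N. Proof. lia. Qed.
Let le_tn : (t <= n)%N. Proof. lia. Qed.
Let eq_nt : (n == t) = false. Proof. by apply/eqP; lia. Qed.

Definition arc_gens : 'cV[S]_n.+1 := \col_i 'X_[mA i].

(* Row i is x_{i+t} e_i - x_i e_{i+1}. *)
Definition arc_syz : 'M[S]_n.+1 := \matrix_(i, j)
  ((if j == i then 'X_(rot_ord i t) else 0)
   - (if j == rot_ord i 1 then 'X_i else 0)).

(* Entry i is the quotient of x_0 ... x_n by lcm(x_{A_i}, x_{A_{i+1}}). *)
Definition arc_syz2 : 'rV[S]_n.+1 :=
  \row_i 'X_[set_mnm [set v | (t < cdist i v)%N]].

Lemma rot_prev j : rot_ord (prev j) 1 = j.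
Proof.
apply/val_inj; have := rot_ordE j (leqnn n); have := rot_ordE (prev j) n_gt0.
by have := ltn_ord j => /=; lia.
Qed.

Lemma prev_rot j : prev (rot_ord j 1) = j.
Proof.
apply/val_inj; have := rot_ordE j n_gt0; have := rot_ordE (rot_ord j 1) (leqnn n).
by have := ltn_ord j => /=; lia.
Qed.

Lemma eq_rot j d e : (d <= n)%N -> (e <= n)%N ->
  (rot_ord j d == rot_ord j e) = (d == e).
Proof.
move=> dn en; apply/eqP/eqP => [/(congr1 (cdist j))|-> //].
by rewrite !cdist_rot.
Qed.

Lemma rot_rot1 j d : (d < n)%N -> rot_ord (rot_ord j 1) d = rot_ord j d.+1.
Proof.
move=> dn; have d1 : (d <= n)%N by lia.
apply/val_inj; have := rot_ordE j n_gt0; have := rot_ordE j dn.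
by have := rot_ordE (rot_ord j 1) d1; have := ltn_ord j => /=; lia.
Qed.

(** Column [j] of [arc_syz] is nonzero only in rows [j] and [prev j]. *)
Lemma mul_arc_syzE p (M : 'M[S]_(p, n.+1)) k j :
  (M *m arc_syz) k j = M k j * 'X_(rot_ord j t) - M k (prev j) * 'X_(prev j).
Proof.
rewrite mxE.
under eq_bigr => i _ do rewrite mxE mulrBr.
rewrite sumrB (bigD1 j) //= eqxx big1 ?addr0; last first.
  by move=> i /negPf ij; rewrite eq_sym ij mulr0.
congr (_ - _); rewrite (bigD1 (prev j)) //= rot_prev eqxx big1 ?addr0 //.
move=> i ij; case: eqP => [e|]; last by rewrite mulr0.
by rewrite e prev_rot eqxx in ij.
Qed.

(** Both sides are the exponent of the union of two consecutive arcs. *)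
Lemma mnm_arc_next i : (U_(rot_ord i t) + mA i = U_(i) + mA (rot_ord i 1))%MM.
Proof.
apply/mnmP=> v; rewrite !mnmDE !mnm1E !set_mnmE !in_arc.
rewrite -!val_eqE /=; have := rot_ordE i n_gt0; have := rot_ordE i le_tn.
have := cdistE i v; have := cdistE (rot_ord i 1) v.
by have := ltn_ord i; have := ltn_ord v; lia.
Qed.

(** Both sides are the exponent of the complement of the arc at [j]. *)
Lemma mnm_co_arc_prev j :
  (set_mnm [set v | (t < cdist j v)%N] + U_(rot_ord j t)
   = set_mnm [set v | (t < cdist (prev j) v)%N] + U_(prev j))%MM.
Proof.
apply/mnmP=> v; rewrite !mnmDE !mnm1E !set_mnmE !inE.
rewrite -!val_eqE /=; have := rot_ordE j (leqnn n); have := rot_ordE j le_tn.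
have := cdistE j v; have := cdistE (prev j) v.
by have := ltn_ord j; have := ltn_ord v; lia.
Qed.

Lemma arc_syz_gens : arc_syz *m arc_gens = 0.
Proof.
apply/matrixP=> i z; rewrite !mxE.
under eq_bigr => j _ do rewrite !mxE mulrBl.
rewrite sumrB (bigD1 i) //= eqxx big1 ?addr0; last first.
  by move=> j /negPf ij; rewrite ij mul0r.
rewrite (bigD1 (rot_ord i 1)) //= eqxx [X in _ - (_ + X)]big1 ?addr0; last first.
  by move=> j /negPf ij; rewrite ij mul0r.
by rewrite -!mpolyXD mnm_arc_next subrr.
Qed.

Lemma arc_syz2_syz : arc_syz2 *m arc_syz = 0.
Proof.
apply/matrixP=> z j; rewrite mul_arc_syzE !mxE -!mpolyXD.
by rewrite mnm_co_arc_prev subrr.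
Qed.

Lemma arc_syz2_neq0 : arc_syz2 != 0.
Proof.
apply/eqP=> /matrixP/(_ 0 0)/(congr1 (mcoeff (set_mnm [set v | (t < cdist 0%R v)%N]))).
by rewrite !mxE mcoeffX eqxx mcoeff0 => /eqP; rewrite oner_eq0.
Qed.

Lemma mx_homog_gens : mx_homog t arc_gens.
Proof.
by move=> i j; rewrite mxE dhomogX /= mdeg_set_mnm card_arc //; lia.
Qed.

Lemma mx_homog_syz : mx_homog 1 arc_syz.
Proof.
move=> i j; rewrite mxE rpredB //; case: ifP => _; rewrite ?rpred0 //;
  by rewrite dhomogX /= mdeg1.
Qed.

Lemma set_mnm_arc_le i m :
  (set_mnm (carc t i) <= m)%MM -> mdeg m = t -> m = mA i.
Proof.
move=> le md; apply/esym/mnm_le_mdeg => //.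
by rewrite mdeg_set_mnm card_arc ?md //; lia.
Qed.

Lemma set_mnm_arc_sub i j v : (mA i <= U_(v) + mA j)%MM ->
  carc t i \subset v |: carc t j.
Proof.
rewrite set_mnm_le => sub; apply/subsetP=> u /(forall_inP sub).
rewrite mnmDE mnm1E set_mnmE !inE [v == u]eq_sym.
by case: (u == v); case: (cdist j u < t)%N.
Qed.

Lemma mcoeff_gens i j : (arc_gens i 0)@_(mA j) = (i == j)%:R.
Proof.
rewrite mxE mcoeffX (inj_eq (@set_mnm_inj _)) (inj_eq (arc_inj _ _)) //; lia.
Qed.

Lemma cmx_gens_mcoeff p (M : 'M[K]_(p, n.+1)) k j :
  ((cmx n.+1 M *m arc_gens) k 0)@_(mA j) = M k j.
Proof.
rewrite mxE raddf_sum (bigD1 j) //= mxE mcoeffCM mcoeff_gens eqxx mulr1.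
rewrite big1 ?addr0 // => i /negPf ij.
by rewrite mxE mcoeffCM mcoeff_gens ij mulr0.
Qed.

Lemma cmx_gens_inj p :
  injective (fun M : 'M[K]_(p, n.+1) => cmx n.+1 M *m arc_gens).
Proof.
by move=> M N e; apply/matrixP=> k j; rewrite -!cmx_gens_mcoeff e.
Qed.

(** In column [j] the variable x_{j+t} comes only from sigma_j, since j + t and j - 1 are distinct
    vertices. So the sigma_i are independent over K. *)
Lemma cmx_syz_mcoeff p (M : 'M[K]_(p, n.+1)) k j :
  ((cmx n.+1 M *m arc_syz) k j)@_U_(rot_ord j t) = M k j.
Proof.
rewrite mul_arc_syzE mcoeffB !mxE !mcoeffCM !mcoeffXU eqxx mulr1.
by rewrite (eq_rot j (leqnn n) le_tn) eq_nt mulr0 subr0.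
Qed.

Lemma cmx_syz_inj p :
  injective (fun M : 'M[K]_(p, n.+1) => cmx n.+1 M *m arc_syz).
Proof.
by move=> M N e; apply/matrixP=> k j; rewrite -!cmx_syz_mcoeff e.
Qed.

(** The coefficient of x_{i+t} in column [i] must be that of sigma_i. All other coefficients follow
    by comparing the monomials x_v m_j in [D *m arc_gens]. *)
Lemma linear_syz_gens p (D : 'M[S]_(p, n.+1)) :
  mx_homog 1 D -> D *m arc_gens = 0 -> exists R, D = cmx n.+1 R *m arc_syz.
Proof.
move=> D1 Dz; exists (\matrix_(k, i) (D k i)@_U_(rot_ord i t)).
apply/matrixP=> k j; apply/eqP; rewrite -subr_eq0; apply/eqP.
apply: linearE_mcoeff => [|v].
  rewrite rpredB ?D1 // mul_arc_syzE rpredB // !mxE mul_mpolyC dhomogZ //;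
  by rewrite dhomogX /= mdeg1.
rewrite mul_arc_syzE !mxE !mcoeffB !mcoeffCM !mcoeffXU.
have [<-|vt] := eqVneq (rot_ord j t) v.
  by rewrite (eq_rot j (leqnn n) le_tn) eq_nt mulr0 mulr1 subr0 subrr.
rewrite mulr0 sub0r opprK.
(* By [arc_sub], x_v m_j is a multiple of m_j and, as v is not j + t, of no other generator except
   m_{j-1} when v = j - 1. *)
move/matrixP: Dz => /(_ k 0)/(congr1 (mcoeff (U_(v) + mA j)%MM)).
rewrite !mxE mcoeff0 raddf_sum (bigD1 j) //= mxE addmC mcoeffMX => <-.
congr (_ + _); have [pv|pv] := eqVneq; last first.
  rewrite mulr0 big1 // => i ij; rewrite mxE.
  apply/eqP; apply: contraNT ij => /mcoeffMX_le.
  rewrite addmC => /set_mnm_arc_sub/(arc_sub t_gt1 (ltnW lt_t_n))[->//|[e]|[e]].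
    by rewrite e eqxx in vt.
  by rewrite e eqxx in pv.
have jp : prev j != j by rewrite -[X in _ != X]rot0 eq_rot; lia.
(* Here x_{j-1} m_j = x_{j-1+t} m_{j-1}, which brings in the entry of [D] that defines the
   coefficient of sigma_{j-1}. *)
rewrite -pv mulr1 (bigD1 (prev j)) //= mxE.
have := mnm_arc_next (prev j); rewrite rot_prev [(mA j + _)%MM]addmC => <-.
rewrite addmC mcoeffMX big1 ?addr0 // => i /andP[ij ipj]; rewrite mxE.
apply/eqP; apply: contraNT ij => /mcoeffMX_le.
have := mnm_arc_next (prev j); rewrite rot_prev [(mA _ + U_(rot_ord _ t))%MM]addmC => ->.
move/set_mnm_arc_sub/(arc_sub t_gt1 (ltnW lt_t_n)) => [->//|[/eqP]|[_ e]].
  by rewrite (eq_rot j (leqnn n) le_tn) eq_nt.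
by rewrite e eqxx in ipj.
Qed.

Lemma mulX_eq_mcoeff (p q : S) i j u :
  p * 'X_i = q * 'X_j -> i != j -> p@_U_(u) != 0 -> u = j.
Proof.
move=> e ij; rewrite -(mcoeffMX p U_(i)) e => /mcoeffMX_le/mnm_lepP/(_ j).
rewrite mnmDE !mnm1E eqxx (negPf ij) add0n.
by case: (eqVneq u j).
Qed.

(** Columns i and i + 1 show that x_{i-1} and x_{i+t+1} both divide entry i. These variables differ
    because t + 1 < n, so a linear entry must vanish. *)
Lemma linear_syz_syz p (M : 'M[S]_(p, n.+1)) :
  mx_homog 1 M -> M *m arc_syz = 0 -> M = 0.
Proof.
move=> M1 Mz; apply/matrixP=> k i; rewrite mxE.
apply: linearE_mcoeff => // u; apply/eqP/negPn/negP => nz.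
have E j : M k j * 'X_(rot_ord j t) = M k (prev j) * 'X_(prev j).
  by apply/eqP; rewrite -subr_eq0 -mul_arc_syzE Mz mxE.
have := mulX_eq_mcoeff (E i) _ nz; rewrite eq_rot; try lia.
move=> up; have {}up : u = prev i by apply: up; lia.
have := E (rot_ord i 1); rewrite prev_rot rot_rot1; last lia.
move/esym/mulX_eq_mcoeff => /(_ u); rewrite -[X in X != _]rot0 eq_rot //; last lia.
move=> /(_ isT nz) /eqP; rewrite up eq_rot; lia.
Qed.

Lemma gens_in_ideal i : J (arc_gens i 0).
Proof.
apply: ideal_gen_sub; exists (carc t i); first by apply: arc_connected; lia.
by rewrite mxE set_monomialE.
Qed.

Lemma ideal_mcoeff f m : J f -> f@_m != 0 -> exists i, (mA i <= m)%MM.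
Proof.
move=> Jf nz.
have [|_ [i ->] le] := ideal_gen_mcoeff (Q := fun m' => exists i, m' = mA i) _ Jf nz.
  have t0n : (0 < t <= n)%N by rewrite ltnW.
  move=> g [C /(t_connected_arc t0n)[i ->] ->].
  by exists (mA i); [exists i | rewrite set_monomialE].
by exists i.
Qed.

(** The only monomials of degree t in J are the m_i, so coefficients can be read off there. *)
Lemma ideal_homog_gens p (F : 'cV[S]_p) : mx_homog t F ->
  (forall k, J (F k 0)) -> exists P, F = cmx n.+1 P *m arc_gens.
Proof.
move=> Ft FJ; exists (\matrix_(k, i) (F k 0)@_(mA i)).
apply/matrixP=> k z; rewrite ord1 {z}; apply/mpolyP=> m.
have [i /eqP ->|no] := pickP (fun i => m == mA i).
  by rewrite cmx_gens_mcoeff mxE.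
have z : (F k 0)@_m = 0.
  apply/eqP/negPn/negP => nz; have [i le] := ideal_mcoeff (FJ k) nz.
  have := no i; rewrite (set_mnm_arc_le le) ?eqxx //.
  by apply/eqP; apply: contraNT nz => nd; apply/eqP/(dhomog_nemf_coeff (Ft k 0)).
rewrite z mxE raddf_sum big1 //= => i _.
by rewrite !mxE mcoeffCM mcoeffX eq_sym no mulr0.
Qed.

Lemma cycle_no_linear_resolution : ~ has_linear_resolution t J.
Proof.
move=> [b [F [[aug_h diff_h] [res_aug res0 res1] _] bF] b0].
have sh (i : nat) (k : 'I_(rk F i)) : shift k = (i + t)%N.
  apply/eqP/negPn/negP => /b0; rewrite bF => /eqP; rewrite cards_eq0.
  by move/eqP/setP/(_ k); rewrite !inE eqxx.
have aug1 : mx_homog t (aug F).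
  by move=> k z; rewrite ord1; have := aug_h k; rewrite sh add0n.
have diff1 (i : nat) : mx_homog 1 (diff F i).
  move=> k l; case: (diff_h i k l) => [->|[_]]; first exact: rpred0.
  by rewrite !sh addSn subSnn.
have augJ k : J (aug F k 0).
  apply/res_aug; exists (delta_mx 0 k).
  by rewrite -rowE; apply/matrixP=> i j; rewrite !ord1 !mxE eqxx.
have d0aug : diff F 0 *m aug F = 0.
  apply/row_matrixP=> i; rewrite row_mul row0; apply/res0.
  by exists (delta_mx 0 i); rewrite -rowE.
have d1d0 : diff F 1 *m diff F 0 = 0.
  apply/row_matrixP=> i; rewrite row_mul row0; apply/res1.
  by exists (delta_mx 0 i); rewrite -rowE.
have [P augP] := ideal_homog_gens aug1 augJ.
have [V gensV] : exists V, arc_gens = V *m aug F.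
  apply: row_solve => i; have /res_aug[v vE] := gens_in_ideal i.
  by exists v; rewrite vE; apply/matrixP=> x y; rewrite !ord1 !mxE eqxx.
(* [aug F] and [arc_gens] both have degree t, so only the constant part of [V] matters. *)
pose Q := coef0_mx V.
have gensQ : arc_gens = cmx _ Q *m aug F.
  by rewrite {1}gensV (mx_homog_mul aug1) // -gensV; apply: mx_homog_gens.
have QP : Q *m P = 1%:M.
  by apply: cmx_gens_inj => /=; rewrite cmx1 mul1mx cmxM -mulmxA -augP.
have PQ : P *m Q = 1%:M.
  (* This constant matrix annihilates [aug F], so it factors through [diff F 0], whose entries are
     linear; hence it is zero. *)
  have [W WE] : exists W, cmx n.+1 (P *m Q - 1%:M) = W *m diff F 0.
    apply: row_solve => i; apply/res0; rewrite -row_mul.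
    have -> : cmx n.+1 (P *m Q - 1%:M) = cmx n.+1 (P *m Q) - 1%:M.
      by rewrite -(cmx1 K n.+1); apply: map_mxB.
    by rewrite mulmxBl mul1mx cmxM -mulmxA -gensQ -augP subrr row0.
  apply/eqP; rewrite -subr_eq0 -(cmxK n.+1 (_ - _)) WE coef0_mxM.
  by rewrite (mx_homog_coef0 _ (diff1 0%N)) // mulmx0.
pose D := diff F 0 *m cmx n.+1 P.
have D1 : mx_homog 1 D by apply: mx_homogMr.
have [R DR] : exists R, D = cmx n.+1 R *m arc_syz.
  by apply: linear_syz_gens => //; rewrite -mulmxA -augP.
have [W syzW] : exists W, arc_syz *m cmx n.+1 Q = W *m diff F 0.
  apply: row_solve => i; apply/res0.
  by rewrite -row_mul -mulmxA -gensQ arc_syz_gens row0.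
have syzD : arc_syz = W *m D.
  by rewrite mulmxA -syzW -mulmxA -cmxM QP cmx1 mulmx1.
pose T := coef0_mx W.
have syzT : arc_syz = cmx n.+1 T *m D.
  by rewrite {1}syzD (mx_homog_mul D1) // -syzD; apply: mx_homog_syz.
have TR : T *m R = 1%:M.
  by apply: cmx_syz_inj => /=; rewrite cmx1 mul1mx cmxM -mulmxA -DR.
(* In sigma coordinates the image of F_2 consists of linear relations between the sigma_i, hence is
   zero. *)
have E0 : diff F 1 *m cmx n.+1 R = 0.
  apply: linear_syz_syz; first exact: mx_homogMr.
  by rewrite -mulmxA -DR mulmxA d1d0 mul0mx.
(* The relation [arc_syz2], moved to F_1 by [T], is a cycle and thus a boundary; applying [R]
   returns it and makes it zero. *)
have [x xE] : exists x, arc_syz2 *m cmx n.+1 T = x *m diff F 1.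
  apply/res1; transitivity (arc_syz2 *m (cmx n.+1 T *m D) *m cmx n.+1 Q).
    by rewrite /D !mulmxA -[RHS]mulmxA -cmxM PQ cmx1 mulmx1.
  by rewrite -syzT arc_syz2_syz mul0mx.
have : arc_syz2 = 0.
  by rewrite -[LHS]mulmx1 -cmx1 -TR cmxM mulmxA xE -mulmxA E0 mulmx0.
exact/eqP/arc_syz2_neq0.
Qed.

End CycleSyzygies.

(** * Orders of the arc monomials *)
Section CycleQuotients.
Local Open Scope ring_scope.
Variables (K : fieldType) (n t : nat).
Hypotheses (t_gt1 : (1 < t)%N) (lt_t_n : (t.+1 < n)%N).
Local Notation S := {mpoly K[n.+1]}.
Local Notation J := (connected_ideal K t (cycle_graph n.+1)).
Implicit Types i j k l v u : 'I_n.+1.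

Local Notation mA i := (set_mnm (carc t i)).

Lemma set_mnm_arc_inj : injective (fun i => mA i).
Proof. by move=> i j /set_mnm_inj/arc_inj; apply; lia. Qed.

Lemma mingen_ideal m : mingen J m <-> exists i, m = mA i.
Proof.
have XJ i : J 'X_[mA i].
  by have := gens_in_ideal K t_gt1 lt_t_n i; rewrite mxE.
have ex m' : J 'X_[m'] -> exists i, (mA i <= m')%MM.
  move=> /(ideal_mcoeff t_gt1 lt_t_n); apply.
  by rewrite mcoeffX eqxx oner_neq0.
split=> [[/ex[i le] min]|[i ->]]; first by exists i; apply/esym/min.
split=> // m' /ex[j le'] le; apply: mnm_le_mdeg => //.
have [a [b [ea eb]]] : exists a b, m' = (a + mA j)%MM /\ mA i = (b + m')%MM.
  by exists (m' - mA j)%MM, (mA i - m')%MM; rewrite !submK.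
have : mdeg (mA i) = mdeg (mA j) by rewrite !mdeg_set_mnm !card_arc //; lia.
by have := congr1 mdeg ea; have := congr1 mdeg eb; rewrite !mdegD; lia.
Qed.

(** The colon contains the monomial of A_j minus A_k, so one of its variables x_v generates. Then an
    earlier arc divides x_v m_k, and by [arc_sub] it is a neighbour of A_k with v as its new
    vertex. *)
Lemma cycle_colon (s : seq 'X_{1..n.+1}) k j (A : {set 'I_n.+1}) :
    (forall m, m \in s -> exists i, m = mA i) ->
    mA k \notin s -> mA j \in s ->
    (forall f : S, colon_principal (monomial_ideal_of s) 'X_[mA k] f
       <-> variable_ideal_of A f) ->
  exists2 v, v \in carc t j :\: carc t k &
    v = rot_ord k t /\ mA (rot_ord k 1) \in s \/ v = rot_ord k n /\ mA v \in s.
Proof.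
move=> sA ks js colon.
have : variable_ideal_of (K := K) A 'X_[set_mnm (carc t j :\: carc t k)].
  apply/colon; rewrite /colon_principal -mpolyXD.
  apply: (@ideal_gen_mpolyX _ _ _ _ (mA j)); first by exists (mA j).
  apply/mnm_lepP=> v; rewrite mnmDE !set_mnmE in_setD.
  by case: (v \in carc t j); case: (v \in carc t k).
move/ideal_gen_mcoeff => /(_ (fun m => exists2 v, v \in A & m = U_(v)%MM)).
move=> /(_ (set_mnm (carc t j :\: carc t k)))[||_ [v vA ->] le].
- by move=> g [v vA ->]; exists U_(v)%MM => //; exists v.
- by rewrite mcoeffX eqxx oner_neq0.
exists v.
  by move/mnm_lepP/(_ v): le; rewrite mnm1E eqxx set_mnmE lt0b.
have : variable_ideal_of (K := K) A 'X_v by apply: ideal_gen_sub; exists v.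
move/colon; rewrite /colon_principal -mpolyXD.
move/ideal_gen_mcoeff => /(_ (fun m => m \in s) (U_(v) + mA k)%MM)[||m ms].
- by move=> g [m ms ->]; exists m.
- by rewrite mcoeffX eqxx oner_neq0.
have [l lm] := sA _ ms; rewrite {m}lm in ms * => /set_mnm_arc_sub/(arc_sub t_gt1 (ltnW lt_t_n)).
case=> [lk|[-> lk]|[-> lk]]; first by rewrite lk (negPf ks) in ms.
  by left; rewrite -lk.
by right; rewrite -lk.
Qed.

Lemma cycle_no_linear_quotients : ~ has_linear_quotients J.
Proof.
move=> [s [s_uniq sJ colon]].
have sP m : m \in s <-> exists i, m = mA i by rewrite sJ mingen_ideal.
have size_s : size s = n.+1.
  have : perm_eq s [seq mA i | i <- enum 'I_n.+1].
    apply: uniq_perm => // [|m]; first by rewrite (map_inj_uniq set_mnm_arc_inj) enum_uniq.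
    apply/idP/mapP => [/sP[i ->]|[i _ ->]]; last by apply/sP; exists i.
    by exists i; rewrite ?mem_enum.
  by move/perm_size => ->; rewrite size_map size_enum_ord.
have nthA (i : nat) : (i < n.+1)%N -> exists k, nth 0%MM s i = mA k.
  by move=> le; apply/sP; rewrite mem_nth ?size_s.
have takeS (i : nat) k : (i < n.+1)%N -> nth 0%MM s i = mA k ->
  forall j, (mA j \in take i.+1 s) = (j == k) || (mA j \in take i s).
  move=> le nk j; rewrite (take_nth 0%MM) ?size_s // mem_rcons inE nk.
  by rewrite (inj_eq set_mnm_arc_inj).
have notin (i : nat) k : (i < n.+1)%N -> nth 0%MM s i = mA k -> mA k \notin take i s.
  move=> le nk; have := take_uniq i.+1 s_uniq.
  by rewrite (take_nth 0%MM) ?size_s // rcons_uniq nk => /andP[].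
have step (i : nat) k j : (0 < i <= n)%N -> nth 0%MM s i = mA k -> mA j \in take i s ->
  exists2 v, v \in carc t j :\: carc t k &
    v = rot_ord k t /\ mA (rot_ord k 1) \in take i s
    \/ v = rot_ord k n /\ mA v \in take i s.
  move=> /andP[i0 le] nk js; case: (colon i) => [|A]; first by rewrite size_s i0.
  rewrite nk => /cycle_colon; apply=> //; last exact: notin.
  by move=> m /mem_take/sP.
have n1 : (1 <= n)%N by lia.
have intv (i : nat) : (0 < i < n)%N ->
  exists a, forall j, (mA j \in take i s) = (cdist a j < i)%N.
  elim: i => // -[_ _|i IH /andP[_ lt_in]].
    have [a na] := nthA 0%N isT; exists a => j.
    rewrite (takeS _ a) // take0 in_nil orbF -val_eqE /=.
    by have := cdistE a j; have := ltn_ord a; have := ltn_ord j; lia.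
  have [|a aP] := IH; first by rewrite /= ltnW.
  have [k nk] := nthA i.+1 (leqW (ltnW lt_in)).
  have ik : (i < cdist a k)%N.
    by have := notin i.+1 k (leqW (ltnW lt_in)) nk; rewrite aP -leqNgt.
  have a_in : mA a \in take i.+1 s by rewrite aP cdistii.
  have [v _ vP] := step i.+1 k a (ltnW (ltnW lt_in)) nk a_in.
  (* A neighbour of [k] is already in the interval, so [k] extends it at its beginning or at its
     end. *)
  have [ka|ka] : cdist a k = n \/ cdist a k = i.+1.
    move: vP; rewrite !aP; have := rot_ordE k n1; have := rot_ordE k (leqnn n).
    have := cdistE a (rot_ord k 1); have := cdistE a v; have := cdistE a k.
    have := ltn_ord a; have := ltn_ord k.
    by move=> ? ? ? ? ? ? ? [[_ ?]|[/(congr1 val) /= ? ?]]; lia.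
  - exists k => j; rewrite (takeS _ k) ?(leqW (ltnW lt_in)) // aP -val_eqE /=.
    have := cdistE a j; have := cdistE k j; have := cdistE a k.
    by have := ltn_ord a; have := ltn_ord j; have := ltn_ord k; lia.
  - exists a => j; rewrite (takeS _ k) ?(leqW (ltnW lt_in)) // aP -val_eqE /=.
    have := cdistE a j; have := cdistE a k.
    by have := ltn_ord a; have := ltn_ord j; have := ltn_ord k; lia.
have [|a aP] := intv n.-1; first by lia.
have [|k nk] := nthA n.-1; first by lia.
have ak : (n.-1 <= cdist a k)%N.
  by have := notin n.-1 k; rewrite aP -leqNgt; apply=> //; lia.
have nn : (0 < n.-1 <= n)%N by lia.
have contra d : (d < n.-1)%N ->
  exists2 v, v \in carc t (rot_ord a d) :\: carc t k &
    v = rot_ord k t /\ (cdist a (rot_ord k 1) < n.-1)%N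
    \/ v = rot_ord k n /\ (cdist a v < n.-1)%N.
  move=> dn; have [|v vj vP] := step _ _ (rot_ord a d) nn nk.
    by rewrite aP cdist_rot //; lia.
  by exists v => //; rewrite -!aP.
have := cdist_le a k; have := cdistE a k; have := ltn_ord k => kn kE ka.
have le_tn : (t <= n)%N by lia.
have := rot_ordE k n1; have := rot_ordE k (leqnn n) => kpE knE.
have := rot_ordE k le_tn => ktE.
have := ltn_ord a => an.
have [e|ne] := eqVneq (cdist a k) n.
  (* Here k = a - 1, and its only earlier neighbour, [a], contributes v = a + t - 1; the arc
     starting at a + t avoids it. *)
  have [|v] := contra t; first lia.
  have := rot_ordE a le_tn => atE.
  rewrite inE !in_arc => /andP[_]; have := cdistE (rot_ord a t) v.
  have := cdistE a v; have := ltn_ord v.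
  by move=> ? ? ? ? [[/(congr1 val) /= ? ?]|[/(congr1 val) /= ? ?]]; lia.
(* Here k = a + n - 1, and its only earlier neighbour contributes v = a + n - 2; the arc starting at
   a + n - 2 - t ends just before it. *)
have le_d : (n - 2 - t <= n)%N by lia.
have := rot_ordE a le_d => adE.
have [|v] := contra (n - 2 - t)%N; first lia.
rewrite inE !in_arc => /andP[_]; have := cdistE (rot_ord a (n - 2 - t)) v.
have := cdistE a v; have := ltn_ord v; have := cdistE a (rot_ord k 1).
by move=> ? ? ? ? ? [[/(congr1 val) /= ? ?]|[/(congr1 val) /= ? ?]]; lia.
Qed.

End CycleQuotients.

Theorem theorem5p2 (K : fieldType) (t : nat) (ht : (2 <= t)%N) :
  [/\ gap_free t (cycle_graph (2 * t + 1)) /\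
      ~ has_linear_resolution t (connected_ideal K t (cycle_graph (2 * t + 1))),
      (3 <= t)%N ->
      gap_free t (cycle_graph (2 * t)) /\
      ~ has_linear_resolution t (connected_ideal K t (cycle_graph (2 * t)))
    & ~ has_linear_quotients (connected_ideal K t (cycle_graph (2 * t + 1))) /\
      ((3 <= t)%N ->
       ~ has_linear_quotients (connected_ideal K t (cycle_graph (2 * t))))].
Proof.
(* With n + 1 vertices, n is 2t or 2t - 1, and t + 1 < n becomes t > 1 or t > 2. *)
have e1 : (2 * t + 1 = (2 * t).+1)%N by rewrite addn1.
have e2 : (2 * t = (2 * t).-1.+1)%N by lia.
split.
- rewrite e1; split; first by apply: cycle_gap_free; lia.
  by apply: cycle_no_linear_resolution; lia.
- move=> ht3; rewrite e2; split; first by apply: cycle_gap_free; lia.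
  by apply: cycle_no_linear_resolution; lia.
- split=> [|ht3]; [rewrite e1|rewrite e2];
    by apply: cycle_no_linear_quotients; lia.
Qed.
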